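(* Let $X$ be the classical risk process and $L$ the random field (its local time) described in the context. Let $t>0$ and let $g:\mathbb{R}\times\mathbb{R}\to\mathbb{R}$ be a bounded and Borel measurable function. Then for each $\varepsilon>0$, $$E\left[\int_0^t g(X_s,X_{s+\varepsilon}-X_s)\,ds\right]=\int_{\mathbb{R}}E\left[g(x,X_\varepsilon-x_0)\right]\,E\left[L_t(x)\right]dx .$$
   Context: The classical risk process is $X=\{X_t,t\ge 0\}$, $X_t=x_0+ct-\sum_{k=1}^{N_t}R_k$, where $x_0\ge 0$ and $c>0$ are constants, $N=\{N_t,t\ge0\}$ is a homogeneous Poisson process with rate $\alpha>0$, and $\{R_k,k\in\mathbb{N}\}$ is a sequence of i.i.d. non-negative random variables independent of $N$. It is assumed that $R_1$ has finite mean and is an absolutely continuous random variable (its law has a density with respect to Lebesgue measure). $X$ has càdlàg paths, $X_0=x_0$, and $X_{s-}$ denotes the left limit at $s>0$. The random field $L$ is defined for $t\ge 0$ and $x\in\mathbb{R}$ by $$L_t(x)=\frac1c\Big(\tfrac12 1_{\{x\}}(X_t)+1_{(x,\infty)}(X_t)-\tfrac12 1_{\{x\}}(x_0)-1_{(x,\infty)}(x_0)-\sum_{0<s\le t}\{1_{(x,\infty)}(X_s)-1_{(x,\infty)}(X_{s-})\}\Big).$$ It is well defined with probability 1, since almost surely $N_t<\infty$ for all $t>0$, so only finitely many summands are non-zero. *)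

(* Defs.v *)
From HB Require Import structures.
From mathcomp Require Import all_boot all_order all_algebra finmap.
From mathcomp Require Import all_classical all_reals all_analysis.

Set Implicit Arguments.
Unset Strict Implicit.
Unset Printing Implicit Defensive.
Import Order.TTheory GRing.Theory Num.Theory.
Import numFieldNormedType.Exports.
Local Open Scope classical_set_scope.
Local Open Scope ring_scope.

Section independence.
Context (R : realType) (d : measure_display) (T : measurableType d)
  (P : probability T R).

Definition mutually_independent (I : choiceType) (d' : measure_display)
    (S : measurableType d') (X : I -> T -> S) : Prop :=
  forall (J : {fset I}) (B : I -> set S),
    (forall i, i \in J -> measurable (B i)) ->
    (P (\bigcap_(i in [set` J]) (X i @^-1` B i)) =
     \prod_(i <- J) P (X i @^-1` B i))%E.

Definition identically_distributed (I : Type) (d' : measure_display)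
    (S : measurableType d') (X : I -> T -> S) : Prop :=
  forall (i j : I) (B : set S), measurable B ->
    P (X i @^-1` B) = P (X j @^-1` B).

Definition family_sigma (I : Type) (D : set I) (d' : measure_display)
    (S : measurableType d') (X : I -> T -> S) : set (set T) :=
  <<s \bigcup_(i in D) preimage_set_system setT (X i) measurable >>.

Definition independent_systems (F G : set (set T)) : Prop :=
  forall A B : set T, F A -> G B -> (P (A `&` B) = P A * P B)%E.

End independence.

Section risk_process.
Context (R : realType) (d : measure_display) (T : measurableType d)
  (P : probability T R).

(* Only the values N s with 0 <= s are constrained.  The subtraction of nat is
   truncated, which is harmless since paths are a.s. nondecreasing. *)
Record poisson_process (alpha : R) (N : R -> T -> nat) : Prop := {
  poisson_start : {ae P, forall w, N 0 w = 0%N} ;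
  poisson_nondecreasing : {ae P, forall w, forall s u : R,
    0 <= s -> s <= u -> (N s w <= N u w)%N} ;
  poisson_right_continuous : {ae P, forall w, forall s : R,
    0 <= s -> N u w @[u --> s^'+] --> N s w} ;
  poisson_increment : forall (s u : R) (k : nat), 0 <= s -> s < u ->
    P [set w | (N u w - N s w)%N = k] =
    (poisson_pmf (alpha * (u - s)) k)%:E ;
  (* A finite partition s_0 <= ... <= s_n extends to a sequence by repeating
     its last point. *)
  poisson_independent_increments : forall s : nat -> R,
    0 <= s 0%N -> (forall k, s k <= s k.+1) ->
    mutually_independent P (fun k w => (N (s k.+1) w - N (s k) w)%N) }.

Definition has_density (Y : T -> R) : Prop :=
  exists f : R -> R,
    [/\ measurable_fun setT f, (forall x, 0 <= f x) &
        forall B : set R, measurable B ->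
          P (Y @^-1` B) = (\int[lebesgue_measure]_(x in B) (f x)%:E)%E].

(* C k is the (k+1)-st claim size. *)
Definition risk_process (x0 c : R) (N : R -> T -> nat) (C : nat -> T -> R)
    (s : R) (w : T) : R :=
  x0 + c * s - \sum_(k < N s w) C k w.

Definition left_limit (f : R -> R) (s : R) : R := lim (f u @[u --> s^'-]).

(* The sum over ]0, t] is the sum over the finite support of the summand (it is
   0 when that support is infinite, which has probability zero). *)
Definition local_time (x0 c : R) (X : R -> T -> R) (t x : R) (w : T) : R :=
  let at_x : R -> R := \1_[set x] in
  let above_x : R -> R := \1_(`]x, +oo[) in
  c^-1 * (2^-1 * at_x (X t w) + above_x (X t w)
          - 2^-1 * at_x x0 - above_x x0
          - \sum_(s \in `]0, t])
              (above_x (X s w) - above_x (left_limit (X ^~ w) s))).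

End risk_process.

(* Main.v *)
Require Import Defs.
From HB Require Import structures.
From mathcomp Require Import all_boot all_order all_algebra finmap.
From mathcomp Require Import all_classical all_reals all_analysis.
From mathcomp Require Import measurable_realfun ring lra.

Set Implicit Arguments.
Unset Strict Implicit.
Unset Printing Implicit Defensive.
Import Order.TTheory GRing.Theory Num.Theory.
Import numFieldNormedType.Exports.
Local Open Scope classical_set_scope.
Local Open Scope ring_scope.

(** The identity combines two facts.

    The first is probabilistic.  For every [s >= 0] the increment
    [X (s + eps) - X s] is independent of [X s] and distributed as
    [X eps - x0]; hence [g (X s, X (s + eps) - X s)] has the same expectation
    as [h (X s)], where [h x] is the expectation of [g (x, X eps - x0)].
    On the event that [n] claims occur up to time [s] and [m] more occur up to
    [s + eps], the two variables are functions of the first [n] claims and of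
    the next [m] ones, so the statement reduces to [claim_sum_increments] and
    to the independence of the increments of the Poisson process
    ([risk_process_increment_rectangle]).

    The second is a property of each path: [L t] is the density of the
    occupation measure of [X] on [[0, t[].  Between two claims [X] climbs with
    slope [c], so the substitution [x = x0 + c s - S k] on the piece where [k]
    claims have occurred shows that the occupation measure has at [x] the
    density [c^-1] times the number of visits of level [x]
    ([occupation_formula_path]).  The indicator of being strictly above [x]
    changes by [+1] at each visit of [x] and is otherwise modified by the claims
    only, so the number of visits is the change of this indicator from [0] to
    [t] minus the sum of its jumps, which is [c * L t x] up to the two half terms
    ([level_crossings], [local_time_occupation_density]).  These half terms
    vanish unless [x] is [x0] or [X t], which by Tonelli happens for almost no
    [x] with positive probability ([law_atoms_null]).

    Tonelli exchanges the expectation with the integral over the levels for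
    nonnegative [g] ([ge0_increments_occupation]); a bounded [g] is a difference
    of two such functions ([bounded_increments_occupation]).

    The counting process has regular paths almost surely only, and [P] need not
    be complete, so that the integrands of the theorem may fail to be
    measurable.  The computation is therefore done for a modification all of
    whose paths are regular ([poisson_regularization]), and transferred with
    [eq_integral_off_null], which holds for arbitrary functions. *)

(** * Integration *)

Section integration.
Local Open Scope ereal_scope.

Import HBNNSimple.

(** The integral is a supremum over the simple functions below the integrand.
    Cutting such a function to zero on [Z] leaves its integral unchanged and
    places it below [g]; this argument covers functions that are not
    measurable. *)
Lemma ge0_integral_le_off_null (d : measure_display) (T : measurableType d)
    (R : realType) (mu : {measure set T -> \bar R}) (f g : T -> \bar R)
    (Z : set T) :
  measurable Z -> mu Z = 0 -> (forall w, 0 <= f w) -> (forall w, 0 <= g w) ->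
  (forall w, ~ Z w -> f w = g w) ->
  \int[mu]_w f w <= \int[mu]_w g w.
Proof.
move=> mZ Z0 f0 g0 fg; rewrite !ge0_integralTE//.
apply: ge_ereal_sup => _ /= [h hf <-].
have mZc : measurable (~` Z) by exact: measurableC.
apply: ereal_sup_ubound; exists (proj_nnsfun h mZc) => /=.
  move=> w /=; rewrite mindicE/=.
  have [wZ|wZ] := boolP (w \in ~` Z).
    by rewrite mulr1 -fg ?hf//; move: wZ; rewrite inE.
  by rewrite mulr0.
rewrite -!integralT_nnsfun; apply: ge0_ae_eq_integral => //.
- by apply/measurable_EFinP.
- by apply/measurable_EFinP.
- by move=> x _; rewrite lee_fin.
- by move=> x _; rewrite lee_fin.
exists Z; split => // w /= /not_implyP[_]; apply: contra_notP => wZ.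
by rewrite mindicE mem_set// mulr1.
Qed.

Lemma eq_integral_off_null (d : measure_display) (T : measurableType d)
    (R : realType) (mu : {measure set T -> \bar R}) (f g : T -> \bar R)
    (Z : set T) :
  measurable Z -> mu Z = 0 -> (forall w, ~ Z w -> f w = g w) ->
  \int[mu]_w f w = \int[mu]_w g w.
Proof.
move=> mZ Z0 fg; rewrite integralE [RHS]integralE.
congr (_ - _); apply/eqP; rewrite eq_le; apply/andP; split;
  by apply: (ge0_integral_le_off_null mZ) => // w /fg; rewrite ?funeposE ?funenegE => ->.
Qed.

(** The measure that sends [A] to [c] times the length of its preimage agrees
    with the length on intervals. *)
Lemma ge0_integral_affine (R : realType) (a c : R) (f : R -> \bar R) :
  (0 < c)%R -> measurable_fun [set: R] f -> (forall x, 0 <= f x) ->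
  \int[lebesgue_measure]_x f x =
  c%:E * \int[lebesgue_measure]_s f (a + c * s)%R.
Proof.
move=> c0 mf f0.
pose shift := fun s => (a + c * s : measurableTypeR R)%R.
have mshift : measurable_fun [set: measurableTypeR R] shift.
  by apply: measurable_funD => //; apply: measurable_funM.
pose phi : {mfun measurableTypeR R >-> measurableTypeR R} :=
  HB.pack shift (isMeasurableFun.Build _ _ _ _ _ mshift).
have -> : \int[lebesgue_measure]_s f (a + c * s)%R =
    \int[pushforward lebesgue_measure phi]_x f x.
  by rewrite ge0_integral_pushforward.
pose k := NngNum (ltW c0).
rewrite -[RHS](ge0_integral_mscale (pushforward lebesgue_measure phi)
  measurableT k mf)//.
apply: eq_measure_integral => A mA _; apply: lebesgue_measure_unique => //.
move=> _ [[u v]] _ <-; rewrite [X in _ = X]/= /pushforward.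
change (lebesgue_measure [set` `]u, v]] =
  c%:E * lebesgue_measure (shift @^-1` [set` `]u, v]]))%E.
rewrite (_ : shift @^-1` _ = [set` `]((u - a) / c)%R, ((v - a) / c)%R]]); last first.
  apply/seteqP; split=> s /=; rewrite !in_itv/= /shift ltr_pdivrMr// ler_pdivlMr//.
    by move=> /andP[? ?]; apply/andP; split; lra.
  by move=> /andP[? ?]; apply/andP; split; lra.
rewrite !lebesgue_measure_itv/= !lte_fin ltr_pM2r ?invr_gt0// ltrD2r.
case: ifPn => _; last by rewrite mule0.
by rewrite -EFinB -EFinM; congr EFin; field; rewrite gt_eqF.
Qed.

End integration.

Section tonelli_section.
Local Open Scope ereal_scope.
Context (d1 d2 : measure_display) (T1 : measurableType d1)
  (T2 : measurableType d2) (R : realType)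
  (m1 : {sigma_finite_measure set T1 -> \bar R})
  (m2 : {sigma_finite_measure set T2 -> \bar R}).
Variables (D : set T1) (F : T1 * T2 -> \bar R).
Hypotheses (mD : measurable D) (mF : measurable_fun setT F).
Hypothesis F_ge0 : forall z, 0 <= F z.

(* Extension by zero reduces the integral over [D] to one over the whole space,
   to which Tonelli applies. *)
Let F' := F \_ (D `*` setT).

Let F'_ge0 z : 0 <= F' z.
Proof. by rewrite /F' patchE; case: ifPn. Qed.

Let mF' : measurable_fun setT F'.
Proof.
by apply/(measurable_restrictT F); [exact: measurableX|exact: measurable_funTS].
Qed.

Let F'E s w : F' (s, w) = if s \in D then F (s, w) else 0.
Proof.
rewrite /F' patchE; congr (if _ then _ else _).
by apply/idP/idP => [/set_mem[/= /mem_set]//|/set_mem sD]; exact/mem_set.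
Qed.

Let integral_F'E w :
  \int[m1]_(s in D) F (s, w) = \int[m1]_s F' (s, w).
Proof.
by rewrite integral_mkcond; apply: eq_integral => s _; rewrite F'E patchE.
Qed.

Lemma measurable_integral_in :
  measurable_fun setT (fun w => \int[m1]_(s in D) F (s, w)).
Proof.
under eq_fun do rewrite integral_F'E.
exact: (measurable_fun_fubini_tonelli_G F').
Qed.

Lemma fubini_tonelli_in :
  \int[m2]_w \int[m1]_(s in D) F (s, w) =
  \int[m1]_(s in D) \int[m2]_w F (s, w).
Proof.
under eq_integral do rewrite integral_F'E.
rewrite -(@fubini_tonelli _ _ _ _ _ m1 m2 F' mF' F'_ge0) [RHS]integral_mkcond.
apply: eq_integral => s _; rewrite patchE; case: ifPn => sD.
  by apply: eq_integral => w _; rewrite F'E sD.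
by rewrite integral0_eq// => w _; rewrite F'E (negbTE sD).
Qed.

End tonelli_section.

(** * Measures on products *)

Section rectangles.
Context (R : realType).
Local Open Scope ereal_scope.

Lemma finite_measure_rectangles_unique (d1 d2 : measure_display)
    (T1 : measurableType d1) (T2 : measurableType d2)
    (m1 m2 : {measure set (T1 * T2) -> \bar R}) :
  m1 setT < +oo ->
  (forall A B, measurable A -> measurable B -> m1 (A `*` B) = m2 (A `*` B)) ->
  forall E, measurable E -> m1 E = m2 E.
Proof.
move=> m1oo m12; apply: (measure_unique
  [set A `*` B | A in measurable & B in measurable] (fun=> setT)) => //.
- exact: measurable_prod_measurableType.
- move=> _ _ [A mA [B mB <-]] [A' mA' [B' mB' <-]].
  exists (A `&` A'); first exact: measurableI.
  by exists (B `&` B'); [exact: measurableI|rewrite setXI].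
- by move=> _; exists setT => //; exists setT => //; rewrite setXTT.
- exact: bigcup_const.
- by move=> _ [A mA [B mB <-]]; exact: m12.
Qed.

End rectangles.

(** * Sums of independent identically distributed claims *)

Section claims.
Context (R : realType) (d : measure_display) (T : measurableType d)
  (P : probability T R).
Local Open Scope ereal_scope.

(** Conditioning on [A] is encoded by intersecting with [A]; both sides are
    finite measures in [E] that agree on rectangles. *)
Lemma law_of_pair_rectangles (A : set T) (Y Z Y' Z' : T -> R) (k : \bar R) :
  measurable A ->
  measurable_fun setT Y -> measurable_fun setT Z ->
  measurable_fun setT Y' -> measurable_fun setT Z' ->
  0 <= k -> k \is a fin_num ->
  (forall B1 B2, measurable B1 -> measurable B2 ->
    P (A `&` (Y @^-1` B1 `&` Z @^-1` B2)) =
    k * P (Y' @^-1` B1 `&` Z' @^-1` B2)) ->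
  forall E, measurable E ->
    P (A `&` (fun w => (Y w, Z w)) @^-1` E) =
    k * P ((fun w => (Y' w, Z' w)) @^-1` E).
Proof.
move=> mA mY mZ mY' mZ' k0 kfin YZ E mE.
have mYZ : measurable_fun setT (fun w => (Y w, Z w)) by exact: measurable_fun_pair.
have mYZ' : measurable_fun setT (fun w => (Y' w, Z' w)) by exact: measurable_fun_pair.
pose f : {mfun T >-> _} :=
  HB.pack (fun w => (Y w, Z w)) (isMeasurableFun.Build _ _ _ _ _ mYZ).
pose f' : {mfun T >-> _} :=
  HB.pack (fun w => (Y' w, Z' w)) (isMeasurableFun.Build _ _ _ _ _ mYZ').
have k0' : (0 <= fine k)%R by exact: fine_ge0.
have := @finite_measure_rectangles_unique _ _ _ _ _
  (pushforward (mrestr P mA) f) (mscale (NngNum k0') (pushforward P f')).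
rewrite /mscale/= /pushforward /mrestr/= => H.
rewrite -[k]fineK// setIC; apply: H => //.
  rewrite preimage_setT setTI.
  by rewrite (le_lt_trans (probability_le1 P mA))// ltry.
move=> B1 B2 mB1 mB2; rewrite setIC YZ//.
by rewrite -[in LHS](fineK kfin).
Qed.

Variable C : nat -> {RV P >-> R}.

(** The recursion on a list of target sets, rather than an intersection over a
    finite set of indices, makes the inductions below peel off one claim at a
    time. *)
Fixpoint claims_from (n : nat) (s : seq (set R)) : set T :=
  if s is b :: s' then C n @^-1` b `&` claims_from n.+1 s' else setT.

Definition claim_sum (n : nat) (w : T) : R := \sum_(k < n) C k w.

Lemma claim_sumS n w : claim_sum n.+1 w = (claim_sum n w + C n w)%R.
Proof. by rewrite /claim_sum big_ord_recr. Qed.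

Lemma measurable_claim_sum n : measurable_fun setT (claim_sum n).
Proof. by apply: measurable_sum => k. Qed.

Lemma measurable_claims_from n s :
  (forall b, b \in s -> measurable b) -> measurable (claims_from n s).
Proof.
elim: s n => [|b s IH] n ms /=; first exact: measurableT.
apply: measurableI; last by apply: IH => x xs; apply: ms; rewrite inE xs orbT.
by rewrite -[X in measurable X]setTI; apply: measurable_funP => //;
  apply: ms; rewrite inE eqxx.
Qed.

Hypothesis C_indep : mutually_independent P C.
Hypothesis C_id : identically_distributed P C.

Let claims_fromE n s : claims_from n s =
  \bigcap_(i in [set` [fset k in iota n (size s)]%fset])
    (C i @^-1` nth setT s (i - n)).
Proof.
elim: s n => [|b s IH] n /=.
  by rewrite fset_nil set_fset0 bigcap_set0.
rewrite IH; apply/seteqP; split => w.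
  move=> [bw sw] i /=; rewrite !inE => /orP[/eqP ->|]; first by rewrite subnn.
  move=> ni; have := sw i; rewrite /= !inE => /(_ ni).
  move: ni; rewrite mem_iota => /andP[ni _].
  by rewrite -(subnSK ni).
move=> H; split.
  by have := H n; rewrite /= !inE eqxx subnn; apply.
move=> i /=; rewrite !inE => ni.
have := H i; rewrite /= !inE ni orbT => /(_ isT).
move: ni; rewrite mem_iota => /andP[ni _].
by rewrite -(subnSK ni).
Qed.

Lemma probability_claims_from n s : (forall b, b \in s -> measurable b) ->
  P (claims_from n s) = \prod_(b <- s) P (C 0%N @^-1` b).
Proof.
move=> ms; rewrite claims_fromE C_indep; last first.
  move=> i; rewrite !inE mem_iota => /andP[ni iN].
  by apply: (ms _ (mem_nth _ _)); rewrite -(ltn_add2l n) subnKC.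
rewrite (perm_big (iota n (size s))); last first.
  apply: uniq_perm; [exact: fset_uniq|exact: iota_uniq|].
  by move=> i; rewrite !inE.
rewrite (big_nth setT) -{1}[n]addn0 iotaDl big_map.
have -> : iota 0 (size s) = index_iota 0 (size s) by rewrite /index_iota subn0.
rewrite !big_mkord.
apply: eq_bigr => i _; rewrite addKn; apply: C_id.
by apply: ms; rewrite mem_nth.
Qed.

(** Conditionally on [A], the variable [Y] is distributed as [Y'], and the
    claims from index [n] on are independent of [Y] with their usual law.  The
    two cases of interest are [A] the sure event with [Y = Y'] a partial sum,
    and [A] an event on the first claims with [Y] the sum of later ones. *)
Definition iid_tail (A : set T) (Y Y' : T -> R) (n : nat) :=
  forall B s, measurable B -> (forall b, b \in s -> measurable b) ->
    P (A `&` (Y @^-1` B `&` claims_from n s)) =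
    P A * P (Y' @^-1` B) * \prod_(b <- s) P (C 0%N @^-1` b).

(** Both the law of [(Y, C n)] given [A] and the later claims, and that of
    [(Y', C m)], are determined by rectangles, on which the hypotheses give
    their values; the sum of the two coordinates is then a function of the
    pair. *)
Lemma iid_tailS A Y Y' n m : measurable A ->
  measurable_fun setT Y -> measurable_fun setT Y' ->
  iid_tail A Y Y' n ->
  (forall B b, measurable B -> measurable b ->
    P (Y' @^-1` B `&` C m @^-1` b) = P (Y' @^-1` B) * P (C 0%N @^-1` b)) ->
  iid_tail A (Y \+ C n)%R (Y' \+ C m)%R n.+1.
Proof.
move=> mA mY mY' tail indep B s mB ms.
pose k := P A * \prod_(b <- s) P (C 0%N @^-1` b).
have prod_ge0 : 0 <= \prod_(b <- s) P (C 0%N @^-1` b) by exact: prode_ge0.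
have prod_fin : \prod_(b <- s) P (C 0%N @^-1` b) \is a fin_num.
  rewrite -(probability_claims_from 0%N)// fin_num_measure//.
  exact: measurable_claims_from.
have PA_fin : P A \is a fin_num by rewrite fin_num_measure.
(* the event that the two coordinates add up to an element of [B] *)
pose E := [set z : R * R | (z.1 + z.2)%R \in B].
have mE : measurable E.
  rewrite /E; under eq_set do rewrite in_setE.
  rewrite -[X in measurable X]setTI.
  exact: (measurable_funD measurable_fst measurable_snd).
have := @law_of_pair_rectangles (A `&` claims_from n.+1 s) Y (C n) Y' (C m) k
  _ mY _ mY' _ _ _ _ E mE.
have -> : (fun w => (Y' w, C m w)) @^-1` E = (Y' \+ C m)%R @^-1` B.
  by apply/seteqP; split=> w; rewrite /E/= in_setE.
have -> : (fun w => (Y w, C n w)) @^-1` E = (Y \+ C n)%R @^-1` B.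
  by apply/seteqP; split=> w; rewrite /E/= in_setE.
rewrite -[RHS]muleAC => <- //.
- by rewrite setIAC setIA.
- by apply: measurableI => //; exact: measurable_claims_from.
- exact: mule_ge0.
- by rewrite fin_numM.
move=> B1 B2 mB1 mB2.
have ms' b : b \in B2 :: s -> measurable b.
  by rewrite inE => /orP[/eqP -> //|]; exact: ms.
have := tail B1 (B2 :: s) mB1 ms'; rewrite /= big_cons.
rewrite indep// /k => eq1.
rewrite -setIA [_ `&` (Y @^-1` _ `&` _)]setIC -setIA eq1.
by rewrite -!muleA; congr (_ * _); rewrite [RHS]muleC -!muleA.
Qed.

Lemma iid_tail_claim_sum n : iid_tail setT (claim_sum n) (claim_sum n) n.
Proof.
elim: n => [|n IH].
  move=> B s mB ms; rewrite probability_setT mul1e setTI.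
  have [B0|B0] := pselect (B 0%R).
    rewrite (_ : claim_sum 0 @^-1` B = setT).
      by rewrite setTI probability_setT mul1e probability_claims_from.
    by apply/seteqP; split=> w; rewrite /claim_sum/= big_ord0.
  rewrite (_ : claim_sum 0 @^-1` B = set0).
    by rewrite set0I measure0 mul0e.
  by apply/seteqP; split=> w; rewrite /claim_sum/= big_ord0.
have -> : claim_sum n.+1 = (claim_sum n \+ C n)%R.
  by apply/funext => w; rewrite claim_sumS.
apply: iid_tailS => //; [exact: measurable_claim_sum..|].
move=> B b mB mb; have := IH B [:: b] mB.
rewrite /= big_seq1 setTI setIT probability_setT mul1e; apply.
by move=> x; rewrite inE => /eqP ->.
Qed.

(** Induction on [m]: each step adds one claim to the increment and, in the
    comparison variable, the claim [C m], whose independence of [claim_sum m] is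
    a case of the previous lemma. *)
Lemma iid_tail_claim_sumB n m A : measurable A ->
  iid_tail (claim_sum n @^-1` A) (claim_sum (n + m) \- claim_sum n)%R
    (claim_sum m) (n + m).
Proof.
have mS k A' : measurable A' -> measurable (claim_sum k @^-1` A').
  by move=> mA'; rewrite -[X in measurable X]setTI; exact: measurable_claim_sum.
move=> mA; elim: m => [|m IH].
  move=> B s mB ms; rewrite addn0.
  have E0 w : (claim_sum n w - claim_sum n w = 0)%R by rewrite subrr.
  have [B0|B0] := pselect (B 0%R).
    rewrite (_ : claim_sum 0 @^-1` B = setT); last first.
      by apply/seteqP; split=> w; rewrite /claim_sum/= big_ord0.
    rewrite (_ : (claim_sum n \- claim_sum n)%R @^-1` B = setT); last first.
      by apply/seteqP; split=> w; rewrite /= E0.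
    rewrite setTI probability_setT mule1.
    have := @iid_tail_claim_sum n A s mA ms.
    by rewrite setTI probability_setT mul1e.
  rewrite (_ : claim_sum 0 @^-1` B = set0); last first.
    by apply/seteqP; split=> w; rewrite /claim_sum/= big_ord0.
  rewrite (_ : (claim_sum n \- claim_sum n)%R @^-1` B = set0); last first.
    by apply/seteqP; split=> w; rewrite /= E0.
  by rewrite set0I setI0 measure0 mule0 mul0e.
have -> : claim_sum m.+1 = (claim_sum m \+ C m)%R.
  by apply/funext => w; rewrite claim_sumS.
have -> : (claim_sum (n + m.+1) \- claim_sum n)%R =
    ((claim_sum (n + m) \- claim_sum n) \+ C (n + m)%N)%R.
  by apply/funext => w; rewrite /= addnS claim_sumS addrAC.
rewrite addnS; apply: iid_tailS => //.
- exact: mS.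
- by apply: measurable_funB; exact: measurable_claim_sum.
- exact: measurable_claim_sum.
move=> B b mB mb; have := @iid_tail_claim_sum m B [:: b] mB.
rewrite /= big_seq1 setTI setIT probability_setT mul1e; apply.
by move=> x; rewrite inE => /eqP ->.
Qed.

Lemma claim_sum_increments n m A B : measurable A -> measurable B ->
  P (claim_sum n @^-1` A `&` (claim_sum (n + m) \- claim_sum n)%R @^-1` B) =
  P (claim_sum n @^-1` A) * P (claim_sum m @^-1` B).
Proof.
move=> mA mB; have := @iid_tail_claim_sumB n m A mA B [::] mB.
by rewrite /= big_nil mule1 setIT; apply.
Qed.

Lemma family_sigma_claim_sum_increments n m A B :
  measurable A -> measurable B ->
  family_sigma [set: nat] C (claim_sum n @^-1` A `&`
    (claim_sum (n + m) \- claim_sum n)%R @^-1` B).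
Proof.
move=> mA mB.
(* Measurability is inherited from the claims once [T] is given the sigma-algebra
   that they generate. *)
pose G := \bigcup_(i in [set: nat]) preimage_set_system setT (C i) measurable.
have mC k : measurable_fun setT (C k : g_sigma_algebraType G -> R).
  move=> _ E mE; rewrite setTI; apply: sub_sigma_algebra.
  by exists k => //; exists E => //; rewrite setTI.
have mS k : measurable_fun setT (claim_sum k : g_sigma_algebraType G -> R).
  by apply: measurable_sum => i; exact: mC.
have : measurable (claim_sum n @^-1` A `&`
    (claim_sum (n + m) \- claim_sum n)%R @^-1` B : set (g_sigma_algebraType G)).
  apply: measurableI; rewrite -[X in measurable X]setTI; first exact: mS.
  exact: (measurable_funB (mS _) (mS _)).
by [].
Qed.

End claims.

(** * Visits of a level by a single path *)

Section path.
Context (R : realType) (n : R -> nat) (S : nat -> R) (x0 c : R).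
Hypothesis c_gt0 : 0 < c.
Hypothesis n_nd : forall s u : R, 0 <= s -> s <= u -> (n s <= n u)%N.
Hypothesis n_rc : forall s : R, 0 <= s ->
  exists2 e : R, 0 < e & forall u : R, s <= u -> u < s + e -> n u = n s.

Let x s := x0 + c * s - S (n s).
Let above (y v : R) : R := \1_(`]y, +oo[) v.

(** While the count is [k], the path lies on the line
    [s |-> x0 + c s - S k], which meets level [y] at the single time [u].  Hence
    the number of [k] with [level_hit y t k] is the number of visits of [y]
    during [[0, t[]. *)
Definition level_hit (y t : R) (k : nat) : bool :=
  let u := (y - x0 + S k) / c in (0 <= u < t) && (n u == k).

Let jump y s := above y (x s) - above y (left_limit x s).

Let aboveE y v : above y v = (y < v)%R%:R.
Proof. by rewrite /above indicE mem_setE in_itv/= andbT. Qed.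

Let left_limit_const r s m : r < s -> (forall u, r <= u < s -> n u = m) ->
  left_limit x s = x0 + c * s - S m.
Proof.
move=> rs nm; apply/cvg_lim => //.
have : (x0 + c * u - S m) @[u --> s^'-] --> x0 + c * s - S m.
  apply: cvg_at_left_filter.
  by apply: cvgB; [apply: cvgD; [exact: cvg_cst|exact: cvgMr]|exact: cvg_cst].
apply: cvg_trans; apply: near_eq_cvg; near=> u.
rewrite /x nm//; apply/andP; split; near: u.
- exact: nbhs_left_ge.
- exact: nbhs_left_lt.
Unshelve. all: by end_near. Qed.

(* The finite set [A] contains the times up to [t] at which a claim takes the
   path across [y]: the sum over all times is then a finite sum, which
   [balance_step] extends by one term. *)
Let balance K y t := exists A : set R, [/\ finite_set A, A `<=` `]0, t],
  (forall s, 0 < s <= t -> ~ A s -> jump y s = 0) &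
  above y (x t) - above y (x 0) - \sum_(s \in A) jump y s =
  \sum_(k < K) (level_hit y t k)%:R].

(* On [[r, t[] no claim occurs, so the path moves along one line and meets [y]
   there if and only if [y] is at least its value at [r] and less than its left
   limit at [t]; at [t] itself a claim may occur. *)
Let balance_step K y r t m : 0 <= r -> r < t -> (m < K)%N ->
  (forall u, r <= u < t -> n u = m) -> balance K y r -> balance K y t.
Proof.
move=> r0 rt mK nm [A [finA Ar Ajump Asum]].
have t0 : 0 < t by exact: le_lt_trans rt.
exists (A `|` [set t]); split.
- by rewrite finite_setU; split.
- move=> s [/Ar|->] /=; rewrite !in_itv/=.
    by move=> /andP[-> sr]; rewrite (le_trans sr (ltW rt)).
  by rewrite t0 lexx.
- move=> s /andP[s0 st] /not_orP[/= As snt].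
  have [sr|rs] := leP s r; first by apply: Ajump => //; rewrite s0.
  have {}st : s < t by rewrite lt_neqAle st andbT; apply/eqP.
  rewrite /jump (left_limit_const rs (m := m)); last first.
    by move=> u /andP[ru us]; apply: nm; rewrite ru (lt_trans us).
  by rewrite /x nm ?(ltW rs)// subrr.
rewrite fsbigU0//; last first.
  move=> s [/Ar /= + st]; rewrite in_itv/= st => /andP[_]; rewrite leNgt rt//.
have jumpt : jump y t = above y (x t) - above y (x0 + c * t - S m).
  by rewrite /jump (left_limit_const rt nm).
rewrite fsbig_set1 jumpt.
have rct : r * c < t * c by rewrite ltr_pM2r.
have hitE (k : 'I_K) : (level_hit y t k)%:R = (level_hit y r k)%:R +
    (k == Ordinal mK)%:R * ((y < x0 + c * t - S m)%R%:R - (y < x r)%R%:R) :> R.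
  rewrite /level_hit; set u := (y - x0 + S k) / c.
  have [urt|urt] := boolP (r <= u < t).
    have -> : (0 <= u < t) = true by case/andP: urt => ? ->; rewrite (le_trans r0).
    have -> : (0 <= u < r) = false by case/andP: urt => ru _; rewrite andbC ltNge ru.
    rewrite nm//= add0r -val_eqE/= eq_sym.
    have [km|km] := eqVneq (k : nat) m; last by rewrite mul0r.
    case/andP: urt; rewrite /u ler_pdivlMr// ltr_pdivrMr// km => ru ut.
    have -> : y < x0 + c * t - S m by lra.
    have -> : (y < x r) = false.
      by apply/negbTE; rewrite -leNgt /x nm ?lexx ?rt//; lra.
    by rewrite subr0 mulr1.
  have -> : (0 <= u < t) = (0 <= u < r).
    move: urt; rewrite negb_and -!ltNge -leNgt => /orP[ur|tu].
      by rewrite ur (lt_trans ur rt).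
    by rewrite !ltNge tu (le_trans (ltW rt) tu).
  have [km|km] := eqVneq k (Ordinal mK); last by rewrite mul0r addr0.
  rewrite mul1r (_ : (y < _) = (y < x r)) ?subrr ?addr0//.
  move: urt; rewrite /x nm ?lexx ?rt// /u km/= ler_pdivlMr// ltr_pdivrMr//.
  rewrite negb_and -ltNge -leNgt => /orP[h|h]; apply/idP/idP => h'; lra.
under [RHS]eq_bigr => k _ do rewrite hitE.
rewrite [RHS]big_split/= -Asum [\sum_(k < K) _ * _](bigD1 (Ordinal mK))//=.
rewrite eqxx mul1r [\sum_(k < K | _) _]big1; last first.
  by move=> k /negbTE ->; rewrite mul0r.
set J := \sum_(s \in A) _; rewrite !aboveE; ring.
Qed.

(* Induction on a strict bound of the count before [t]: if its largest allowed
   value is attained, it is attained from some first time [r] on, and the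
   induction hypothesis applies at [r]. *)
Let balance_bounded m : forall K y t, (m <= K)%N -> 0 <= t ->
  (forall s, 0 <= s < t -> (n s < m)%N) -> balance K y t.
Proof.
elim: m => [|m IH] K y t mK t0 nm.
  have {nm}-> : t = 0.
    apply/eqP; rewrite eq_le t0 leNgt andbT; apply/negP => tp.
    by have := nm 0; rewrite lexx tp => /(_ isT).
  exists set0; split => //.
  - by move=> s; rewrite leNgt; case/andP => ->.
  rewrite fsbig_set0 subrr subr0 big1// => k _.
  by rewrite /level_hit; case: andP => // -[/andP[h1 h2]]; lra.
have [[s0 /andP[s0ge s0t] s0m]|nom] :=
    pselect (exists2 s, 0 <= s < t & n s = m); last first.
  apply: IH => //; first exact: ltnW.
  move=> s st; have := nm s st; rewrite ltnS leq_eqVlt => /orP[/eqP sm|//].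
  by exfalso; apply: nom; exists s.
pose E := [set s | 0 <= s /\ n s = m].
have E0 : has_inf E.
  by split; [exists s0|exists 0 => s []].
pose r := inf E.
have r0 : 0 <= r by apply: lb_le_inf => [|s []//]; exists s0.
have rs0 : r <= s0 by apply: ge_inf => //; case: E0.
have nr : n r = m.
  have [e e0 ne] := n_rc r0.
  have [s [s0' sm] se] := inf_adherent e0 E0.
  rewrite -(ne s)//; apply: ge_inf => //; case: E0 => //.
apply: (@balance_step K y r t m) => //.
- exact: le_lt_trans s0t.
- move=> u /andP[ru ut]; apply/eqP; rewrite eqn_leq.
  have u0 : 0 <= u by exact: le_trans ru.
  by rewrite -ltnS nm ?u0// -nr n_nd.
apply: IH => //; first exact: ltnW.
move=> s /andP[s0' sr].
have : (n s <= m)%N by rewrite -nr n_nd// ltW.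
rewrite leq_eqVlt => /orP[/eqP sm|//].
suff : r <= s by rewrite leNgt sr.
by apply: ge_inf => //; case: E0.
Qed.

(** No visit is made on a line that is reached after time [t] only. *)
Lemma level_hit_ge y t k : (n t < k)%N -> level_hit y t k = false.
Proof.
move=> tk; apply/negbTE/negP => /andP[/andP[u0 ut] /eqP nk].
by move: tk; rewrite -nk ltnNge n_nd// ltW.
Qed.

(** Being above [y] starts at the visits of [y], and otherwise changes by
    jumps only. *)
Lemma level_crossings y t : 0 <= t ->
  above y (x t) - above y (x 0) - \sum_(s \in `]0, t]) jump y s =
  \sum_(k < (n t).+1) (level_hit y t k)%:R.
Proof.
move=> t0; have [A [finA At Ajump <-]] : balance (n t).+1 y t.
  apply: (@balance_bounded _ _ y t (leqnn _) t0) => s /andP[s0 st].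
  by rewrite ltnS n_nd// ltW.
congr (_ - _); apply/esym/fsbig_widen => // s [/= st As].
by apply: Ajump => //; move: st; rewrite in_itv.
Qed.

End path.

(** * A modification of the counting process with regular paths *)

Section counting.
Context (R : realType) (d : measure_display) (T : measurableType d)
  (P : probability T R).

(** Right continuity of a path with values in the discrete space [nat] is local
    constancy to the right.  Starting from [0] at all negative times spares sign
    conditions in what follows. *)
Record counting_paths (M : R -> T -> nat) : Prop := {
  counting_measurable : forall s, measurable_fun setT (M s) ;
  counting_start : forall s w, s <= 0 -> M s w = 0%N ;
  counting_nd : forall w s u, s <= u -> (M s w <= M u w)%N ;
  counting_rc : forall w s, exists2 e : R, 0 < e &
    forall u, s <= u -> u < s + e -> M u w = M s w }.

Definition regularize (Z : set T) (N : R -> T -> nat) (s : R) (w : T) : nat :=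
  if (w \in Z) || (s <= 0) then 0%N else N s w.

Lemma regularizeE Z N s w : ~ Z w -> 0 < s -> regularize Z N s w = N s w.
Proof.
by move=> Zw s0; rewrite /regularize leNgt s0 orbF; case: ifPn => //; rewrite inE.
Qed.

Lemma poisson_regularization (alpha : R) (N : R -> {RV P >-> nat}) :
  poisson_process P alpha N ->
  exists Z, [/\ measurable Z, P Z = 0%E,
    forall s w, 0 <= s -> ~ Z w -> regularize Z N s w = N s w &
    counting_paths (regularize Z N)].
Proof.
move=> poiN.
have [Z [mZ Z0 Zc]] : {ae P, forall w, [/\ N 0 w = 0%N,
    forall s u : R, 0 <= s -> s <= u -> (N s w <= N u w)%N &
    forall s : R, 0 <= s -> N u w @[u --> s^'+] --> N s w]}.
  apply: filterS3 (poisson_start poiN) (poisson_nondecreasing poiN)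
    (poisson_right_continuous poiN) => w h1 h2 h3; by split.
have good w : ~ Z w -> [/\ N 0 w = 0%N,
    forall s u : R, 0 <= s -> s <= u -> (N s w <= N u w)%N &
    forall s : R, 0 <= s -> N u w @[u --> s^'+] --> N s w].
  by move=> Zw; apply: contrapT => h; apply/Zw/Zc.
exists Z; split => //.
  move=> s w s0 Zw; have [s0'|s0'] := ltP 0 s; first by rewrite regularizeE.
  have {s0 s0'}-> : s = 0 by apply/eqP; rewrite eq_le s0'.
  by rewrite /regularize lexx orbT; have [->] := good _ Zw.
split.
- move=> s.
  have [s0|s0] := leP s 0.
    rewrite (_ : regularize Z N s = cst 0%N)//.
    by apply/funext => w; rewrite /regularize s0 orbT.
  rewrite (_ : regularize Z N s = fun w => if w \in Z then 0%N else N s w).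
    apply: measurable_fun_ifT => //.
    by apply: (measurable_fun_bool true); rewrite setTI;
       rewrite (_ : _ @^-1` _ = Z)//; apply/seteqP; split => w /=;
         [exact: set_mem|exact: mem_set].
  by apply/funext => w; rewrite /regularize leNgt s0 orbF.
- by move=> s w s0; rewrite /regularize s0 orbT.
- move=> w s u su; rewrite /regularize; case: ifPn => //= /norP[/negP].
  rewrite inE -ltNge => Zw s0; rewrite leNgt (lt_le_trans s0)// orbF.
  case: ifPn => [/set_mem//|_].
  by have [_ nd _] := good _ Zw; apply: nd => //; exact: ltW.
- move=> w s.
  have [wZ|wZ] := boolP (w \in Z).
    by exists 1 => // u _ _; rewrite /regularize wZ.
  have Zw : ~ Z w by move: wZ; rewrite notin_setE.
  have [s0|s0] := ltP s 0.
    exists (- s); rewrite ?oppr_gt0// => u su.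
    by rewrite subrr => /ltW u0; rewrite /regularize (ltW s0) u0 orbT.
  have [N0 _ rc] := good _ Zw.
  have regE u : 0 <= u -> regularize Z N u w = N u w.
    rewrite le_eqVlt => /orP[/eqP <-|]; last exact: regularizeE.
    by rewrite /regularize lexx orbT.
  have : nbhs (N s w) [set N s w] by exact: discrete_set1.
  move=> /(rc s s0); rewrite /= => /nbhs_ballP[e /= e0 He].
  exists e => // u su us; rewrite !regE ?(le_trans s0)//.
  move: su; rewrite le_eqVlt => /orP[/eqP -> //|su].
  apply: He => //=; rewrite /ball/= distrC gtr0_norm ?subr_gt0//; lra.
Qed.

End counting.

(** * Independence and stationarity of the increments of the risk process *)

Section law.
Context (R : realType) (d : measure_display) (T : measurableType d)
  (P : probability T R).
Local Open Scope ereal_scope.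

Lemma eq_probability_off_null (Z A B : set T) :
  measurable Z -> P Z = 0 -> measurable A -> measurable B ->
  (forall w, ~ Z w -> A w <-> B w) -> P A = P B.
Proof.
move=> mZ Z0 mA mB AB; rewrite -[A]setIT -[B]setIT -!integral_indic//.
apply: (eq_integral_off_null mZ Z0) => w /AB {}AB.
by rewrite !indicE; congr (_%:R%:E)%R; congr nat_of_bool;
  apply/idP/idP => /set_mem/AB/mem_set.
Qed.

Lemma probability_partition (k : T -> nat) (A : set T) :
  measurable_fun setT k -> measurable A ->
  P A = \sum_(n <oo) P (k @^-1` [set n] `&` A).
Proof.
move=> mk mA.
have mkn n : measurable (k @^-1` [set n]).
  by rewrite -[X in measurable X]setTI; exact: mk.
rewrite {1}(_ : A = \bigcup_n (k @^-1` [set n] `&` A)); last first.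
  apply/seteqP; split => [w Aw|w [n _ []]//]; by exists (k w).
rewrite measure_semi_bigcup//.
- by move=> n; exact: measurableI.
- by apply/trivIsetP => i j _ _ ij; apply/seteqP; split => // w [[/= ki _] [kj _]];
    move: ij; rewrite -ki -kj eqxx.
- by apply: bigcup_measurable => n _; exact: measurableI.
Qed.

Lemma measurable_fun_countable_index (d1 d2 : measure_display)
    (U : measurableType d1) (V : measurableType d2) (k : U -> nat)
    (f : nat -> U -> V) :
  measurable_fun setT k -> (forall n, measurable_fun setT (f n)) ->
  measurable_fun setT (fun u => f (k u) u).
Proof.
move=> mk mf _ B mB; rewrite setTI.
rewrite (_ : _ @^-1` B = \bigcup_n (k @^-1` [set n] `&` f n @^-1` B)).
  apply: bigcup_measurable => n _; apply: measurableI.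
    by rewrite -[X in measurable X]setTI; exact: mk.
  by rewrite -[X in measurable X]setTI; exact: mf.
by apply/seteqP; split => [u Bu|u [n _ [/= <-]]//]; exists (k u).
Qed.

Section increments.
Variables (M : R -> T -> nat) (C : nat -> {RV P >-> R}) (x0 c : R).
Hypothesis M_paths : counting_paths M.
Hypothesis C_indep : mutually_independent P C.
Hypothesis C_id : identically_distributed P C.
Hypothesis M_C : forall (s : R) n F, (0 <= s)%R -> family_sigma [set: nat] C F ->
  P (M s @^-1` [set n] `&` F) = P (M s @^-1` [set n]) * P F.
Hypothesis M_incr_C : forall (s e : R) n m F, (0 <= s)%R -> (0 < e)%R ->
  family_sigma [set: nat] C F ->
  P (M s @^-1` [set n] `&` M (s + e)%R @^-1` [set (n + m)%N] `&` F) =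
  P (M s @^-1` [set n]) * P (M e @^-1` [set m]) * P F.

Let X := risk_process x0 c M C.
Let S := claim_sum C.

Let XE s w : X s w = (x0 + c * s - S (M s w) w)%R. Proof. by []. Qed.

Lemma measurable_risk_process s : measurable_fun setT (X s).
Proof.
apply: measurable_funB => //.
apply: (measurable_fun_countable_index (k := M s) (f := S)).
  exact: counting_measurable.
exact: measurable_claim_sum.
Qed.

Let Ssigma n A : measurable A -> family_sigma [set: nat] C (S n @^-1` A).
Proof.
move=> mA; have := @family_sigma_claim_sum_increments _ _ _ _ C n 0 A setT
  mA measurableT.
by rewrite preimage_setT setIT.
Qed.

Let mS n A : measurable A -> measurable (S n @^-1` A).
Proof.
by move=> mA; rewrite -[X in measurable X]setTI; exact: measurable_claim_sum.
Qed.

Let msub (a : R) B : measurable B -> measurable [set v : R | B (a - v)%R].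
Proof.
move=> mB; have mf : measurable_fun setT (fun v : R => a - v)%R.
  by apply: measurable_funB.
by have := mf measurableT B mB; rewrite setTI.
Qed.

Let law1 s a B : (0 <= s)%R -> measurable B ->
  P [set w | B (a - S (M s w) w)%R] =
  \sum_(n <oo) (P (M s @^-1` [set n]) * P (S n @^-1` [set v | B (a - v)%R])).
Proof.
move=> s0 mB.
have mf : measurable_fun setT (fun w => a - S (M s w) w)%R.
  apply: measurable_funB => //.
  apply: (measurable_fun_countable_index (k := M s) (f := S)).
    exact: counting_measurable.
  exact: measurable_claim_sum.
rewrite (@probability_partition (M s)).
- apply: eq_eseriesr => n _; rewrite -M_C//; last exact: Ssigma (msub _ _).
  by congr (P _); apply/seteqP; split => w /= [<-].
- exact: counting_measurable.
- by have := mf measurableT B mB; rewrite setTI.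
Qed.

(** Summing over the number [n] of claims up to [s] and the number [m] of claims
    in the next [e] time units, each term factors into an expression in [n] times
    an expression in [m], and the double series into the product of two. *)
Lemma risk_process_increment_rectangle s e A B :
  (0 <= s)%R -> (0 < e)%R -> measurable A -> measurable B ->
  P (X s @^-1` A `&` (fun w => X (s + e)%R w - X s w)%R @^-1` B) =
  P (X s @^-1` A) * P ((fun w => X e w - x0)%R @^-1` B).
Proof.
move=> s0 e0 mA mB.
pose a n := P (S n @^-1` [set v | A (x0 + c * s - v)%R]).
pose b m := P (S m @^-1` [set v | B (c * e - v)%R]).
pose p n := P (M s @^-1` [set n]).
pose q m := P (M e @^-1` [set m]).
have b_sum : P ((fun w => X e w - x0)%R @^-1` B) = \sum_(m <oo) (q m * b m).
  rewrite -law1 ?ltW//; congr (P _); apply/seteqP.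
  by split => w /=; rewrite XE; congr B; ring.
have a_sum : P (X s @^-1` A) = \sum_(n <oo) (p n * a n) by rewrite -law1.
have mXs : measurable (X s @^-1` A).
  by rewrite -[X in measurable X]setTI; exact: measurable_risk_process.
have mXD : measurable ((fun w => X (s + e)%R w - X s w)%R @^-1` B).
  rewrite -[X in measurable X]setTI.
  exact: (measurable_funB (measurable_risk_process _) (measurable_risk_process _)).
have mMs k u : measurable (M u @^-1` [set k]).
  by rewrite -[X in measurable X]setTI; exact: counting_measurable.
have q_fin : \sum_(m <oo) (q m * b m) \is a fin_num.
  rewrite -b_sum fin_num_measure// -[X in measurable X]setTI.
  exact: (measurable_funB (measurable_risk_process _) (measurable_cst _)).
rewrite (@probability_partition (M s)); last 2 first.
- exact: counting_measurable.
- exact: measurableI.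
rewrite a_sum b_sum muleC -[X in X * _](fineK q_fin) -nneseriesZl; last first.
  by move=> n _; exact: mule_ge0.
apply: eq_eseriesr => n _; rewrite fineK// [RHS]muleC.
have pa_fin : p n * a n \is a fin_num.
  apply: fin_numM; first by rewrite fin_num_measure.
  by rewrite fin_num_measure//; apply: mS; exact: msub.
rewrite -[X in X * _](fineK pa_fin) -nneseriesZl; last first.
  by move=> m _; exact: mule_ge0.
rewrite (@probability_partition (fun w => M (s + e)%R w - M s w)%N); last 2 first.
- apply: (measurable_fun_countable_index (k := M s)
    (f := fun k w => (M (s + e)%R w - k)%N)); first exact: counting_measurable.
  move=> k _ D _; rewrite setTI -[X in measurable X]setTI.
  exact: (counting_measurable M_paths (s + e) measurableT
    (I : measurable ((subn^~ k) @^-1` D))).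
- by apply: measurableI => //; exact: measurableI.
apply: eq_eseriesr => m _; rewrite fineK//.
rewrite muleACA -claim_sum_increments//; [|exact: msub..].
rewrite -M_incr_C//; last first.
  by apply: family_sigma_claim_sum_increments; exact: msub.
congr (P _); apply/seteqP; split => w /=; rewrite !XE.
  move=> [Mm [Mn [XA XB]]]; split; first split => //.
    by rewrite -Mm -Mn subnKC// counting_nd// lerDl ltW.
  split; first by rewrite -Mn.
  move: XB; have -> : M (s + e)%R w = (n + m)%N.
    by rewrite -Mm -Mn subnKC// counting_nd// lerDl ltW.
  by rewrite Mn /S; congr B; ring.
move=> [[Mn Mm] [XA XB]]; split; first by rewrite Mm Mn addKn.
split => //; rewrite Mn; split => //; rewrite Mm.
by move: XB; rewrite /S; congr B; ring.
Qed.

End increments.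
End law.

Section poisson_independence.
Context (R : realType) (d : measure_display) (T : measurableType d)
  (P : probability T R).
Local Open Scope ereal_scope.

Lemma family_sigma_preimage (I : Type) (D : set I) (d' : measure_display)
    (V : measurableType d') (X : I -> T -> V) i B :
  D i -> measurable B -> family_sigma D X (X i @^-1` B).
Proof.
by move=> Di mB; apply: sub_sigma_algebra; exists i => //; exists B; rewrite ?setTI.
Qed.

Lemma family_sigma_measurable (I : Type) (D : set I) (d' : measure_display)
    (V : measurableType d') (X : I -> T -> V) F :
  (forall i, measurable_fun setT (X i)) -> family_sigma D X F -> measurable F.
Proof.
move=> mX; apply: smallest_sub; first exact: sigma_algebra_measurable.
by move=> _ [i _] [B mB <-]; exact: mX.
Qed.

Variables (alpha : R) (N : R -> {RV P >-> nat}) (C : nat -> {RV P >-> R}).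
Hypothesis N_poisson : poisson_process P alpha N.
Hypothesis NC_indep : independent_systems P
  (family_sigma [set s : R | (0 <= s)%R] N) (family_sigma [set: nat] C).
Variable Z : set T.
Hypotheses (mZ : measurable Z) (PZ : P Z = 0).
Hypothesis regN : forall s w, (0 <= s)%R -> ~ Z w -> regularize Z N s w = N s w.
Hypothesis M_paths : counting_paths (regularize Z N).
Let M := regularize Z N.

Let mM s n : measurable (M s @^-1` [set n]).
Proof. by rewrite -[X in measurable X]setTI; exact: counting_measurable. Qed.

Let mN s n : measurable (N s @^-1` [set n]).
Proof. by rewrite -[X in measurable X]setTI; exact: measurable_funP. Qed.

Let mF F : family_sigma [set: nat] C F -> measurable F.
Proof. by apply: family_sigma_measurable. Qed.

Lemma regularized_poisson_indep s n F : (0 <= s)%R ->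
  family_sigma [set: nat] C F ->
  P (M s @^-1` [set n] `&` F) = P (M s @^-1` [set n]) * P F.
Proof.
move=> s0 CF.
have -> : P (M s @^-1` [set n]) = P (N s @^-1` [set n]).
  by apply: (eq_probability_off_null mZ PZ) => // w Zw; rewrite /= /M regN.
rewrite -NC_indep//; last exact: family_sigma_preimage.
apply: (eq_probability_off_null mZ PZ).
- by apply: measurableI => //; exact: mF.
- by apply: measurableI => //; exact: mF.
- by move=> w Zw; rewrite /= /M regN.
Qed.

(** The increment over [[s, s + e]] has the same Poisson law as the one over
    [[0, e]], which is the value at [e] almost surely. *)
Lemma regularized_poisson_increment_indep s e n m F : (0 <= s)%R -> (0 < e)%R ->
  family_sigma [set: nat] C F ->
  P (M s @^-1` [set n] `&` M (s + e)%R @^-1` [set (n + m)%N] `&` F) =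
  P (M s @^-1` [set n]) * P (M e @^-1` [set m]) * P F.
Proof.
move=> s0 e0 CF; have se0 : (0 <= s + e)%R by rewrite addr_ge0// ltW.
transitivity (P ((N s @^-1` [set n] `&` N (s + e)%R @^-1` [set (n + m)%N]) `&` F)).
  apply: (eq_probability_off_null mZ PZ).
  - by apply: measurableI; [exact: measurableI|exact: mF].
  - by apply: measurableI; [exact: measurableI|exact: mF].
  - by move=> w Zw; rewrite /= /M !regN.
rewrite NC_indep//; last first.
  have : @measurable _ (g_sigma_algebraType (\bigcup_(i in [set s : R | (0 <= s)%R])
      preimage_set_system setT (N i) measurable))
      (N s @^-1` [set n] `&` N (s + e)%R @^-1` [set (n + m)%N]).
    by apply: measurableI; exact: family_sigma_preimage.
  by [].
congr (_ * _).
(* The increments over [[0, s]] and [[s, s + e]] are the first two of this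
   sequence, and almost surely determine [N s] and [N (s + e)]. *)
pose grid (k : nat) : R := match k with 0%N => 0%R | 1%N => s | _ => (s + e)%R end.
have grid0 : (0 <= grid 0%N)%R by [].
have grid_nd k : (grid k <= grid k.+1)%R by case: k => [|[|k]] //=; rewrite lerDl ltW.
pose B (k : nat) : set nat := if k is 0%N then [set n] else [set m].
have /(_ [fset 0%N; 1%N]%fset B) :=
  poisson_independent_increments N_poisson grid0 grid_nd.
have -> : \bigcap_(i in [set` [fset 0%N; 1%N]%fset])
    ((fun w => (N (grid i.+1) w - N (grid i) w)%N) @^-1` B i) =
    [set w | (N s w - N 0%R w)%N = n] `&` [set w | (N (s + e)%R w - N s w)%N = m].
  apply/seteqP; split => w /=.
    move=> H; have := H 0%N; have := H 1%N; rewrite /= !inE /= => h1 h0.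
    by split; [exact: h0|exact: h1].
  by move=> [h0 h1] i; rewrite /= !inE => /orP[]/eqP ->.
rewrite big_fsetU1/= ?inE// big_seq_fset1/= => indep.
have mDN s1 s2 k : measurable [set w | (N s1 w - N s2 w)%N = k].
  have mD : measurable_fun setT (fun w => (N s1 w - N s2 w)%N).
    apply: (measurable_fun_countable_index (k := N s2)
      (f := fun j w => (N s1 w - j)%N)) => // j _ D _.
    exact: (@measurable_funP _ _ _ _ _ (N s1) measurableT ((subn^~ j) @^-1` D) I).
  by rewrite -[X in measurable X]setTI; exact: (mD measurableT [set k] I).
have N0 w : ~ Z w -> N 0%R w = 0%N.
  by move=> Zw; rewrite -regN//; exact: counting_start.
transitivity (P ([set w | (N s w - N 0%R w)%N = n] `&`
    [set w | (N (s + e)%R w - N s w)%N = m])).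
  apply: (eq_probability_off_null mZ PZ); [exact: measurableI..|].
  move=> w Zw /=; rewrite N0// subn0.
  have Nse : (N s w <= N (s + e)%R w)%N.
    by rewrite -!regN// counting_nd// lerDl ltW.
  split => -[hn hm]; split => //; first by rewrite hn hm addKn.
  by rewrite -hn -hm subnKC.
rewrite indep; last by move=> i; rewrite !inE => /orP[]/eqP ->.
congr (_ * _).
  apply: (eq_probability_off_null mZ PZ); [exact: mDN|exact: mM|] => w Zw /=.
  by rewrite N0// subn0 /M regN.
rewrite (poisson_increment N_poisson)// ?ltrDl//.
transitivity (P [set w | (N e w - N 0%R w)%N = m]).
  rewrite (poisson_increment N_poisson)//.
  by congr ((poisson_pmf _ _)%:E); ring.
apply: (eq_probability_off_null mZ PZ); [exact: mDN|exact: mM|] => w Zw /=.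
by rewrite N0// subn0 /M regN// ltW.
Qed.

End poisson_independence.

(** * The occupation density *)

Section occupation.
Context (R : realType) (d : measure_display) (T : measurableType d)
  (P : probability T R).
Local Open Scope ereal_scope.
Variables (M : R -> T -> nat) (C : nat -> {RV P >-> R}) (x0 c : R).
Hypothesis M_paths : counting_paths M.
Hypothesis c_gt0 : (0 < c)%R.

Let X := risk_process x0 c M C.
Let S := claim_sum C.

(** By right continuity and monotonicity, fewer than [k] claims occur up to time
    [s] if and only if the same holds at some rational time after [s]. *)
Lemma measurable_counting_paths :
  measurable_fun [set: R * T] (fun z => M z.1 z.2).
Proof.
have ge_meas k : measurable [set z : R * T | (k <= M z.1 z.2)%N].
  have -> : [set z : R * T | (k <= M z.1 z.2)%N] =
      ~` \bigcup_(q : rat) ([set s : R | (s < ratr q)%R] `*`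
                            [set w | (M (ratr q) w < k)%N]).
    apply/seteqP; split => [[s w] /= kM [q _ [/= /ltW sq Mq]]|[s w] /= H].
      by move: Mq; rewrite ltnNge (leq_trans kM)// counting_nd.
    rewrite leqNgt; apply/negP => Mk; apply: H.
    have [e e0 Me] := counting_rc M_paths w s.
    have [q] : exists q, ratr q \in `]s, (s + e)%R[ by apply: rat_in_itvoo; rewrite ltrDl.
    rewrite in_itv/= => /andP[sq qe].
    by exists q => //; split => //=; rewrite Me// ltW.
  apply: measurableC; apply: bigcupT_measurable_rat => q; apply: measurableX.
    by rewrite (_ : [set s | _] = `]-oo, (ratr q)[%classic)//.
  rewrite -[X in measurable X]setTI.
  exact: (counting_measurable M_paths (ratr q) measurableT
    (I : measurable [set i | (i < k)%N])).
have eq_meas k : measurable [set z : R * T | M z.1 z.2 = k].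
  have -> : [set z : R * T | M z.1 z.2 = k] =
      [set z | (k <= M z.1 z.2)%N] `\` [set z | (k.+1 <= M z.1 z.2)%N].
    apply/seteqP; split => [z /= ->|z /= [kM Mk]]; first by rewrite ltnn.
    by apply/eqP; rewrite eqn_leq kM andbT leqNgt; apply/negP.
  exact: measurableD.
move=> _ B _; rewrite setTI.
rewrite (_ : _ @^-1` B = \bigcup_(k in B) [set z | M z.1 z.2 = k]).
  by apply: bigcup_measurable => k _; exact: eq_meas.
by apply/seteqP; split => [z Bz|z [k Bk /= ->//]]; exists (M z.1 z.2).
Qed.

Lemma measurable_risk_process_joint (d' : measure_display)
    (U : measurableType d') (s : U -> R) (w : U -> T) :
  measurable_fun setT s -> measurable_fun setT w ->
  measurable_fun setT (fun u => X (s u) (w u)).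
Proof.
move=> ms mw.
have mM : measurable_fun setT (fun u => M (s u) (w u)).
  exact: (measurableT_comp measurable_counting_paths (measurable_fun_pair ms mw)).
apply: measurable_funB.
  by apply: measurable_funD => //; apply: measurable_funM.
apply: (measurable_fun_countable_index (f := fun k u => S k (w u)) mM) => k.
exact: (measurableT_comp (measurable_claim_sum C k) mw).
Qed.

Definition hit (t x : R) (w : T) (k : nat) : bool :=
  level_hit (M ^~ w) (S ^~ w) x0 c x t k.

(** [c^-1] times the number of visits of [x] during [[0, t[].  The series form
    is jointly measurable and nonnegative, as Tonelli requires; its terms vanish
    beyond the number of claims up to [t]. *)
Definition occupation_density (t x : R) (w : T) : \bar R :=
  c^-1%:E * \sum_(k <oo) (hit t x w k)%:R%:E.

Lemma measurable_hit (d' : measure_display) (U : measurableType d')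
    (x : U -> R) (w : U -> T) t k :
  measurable_fun setT x -> measurable_fun setT w ->
  measurable_fun setT (fun u => hit t (x u) (w u) k).
Proof.
move=> mx mw.
have mu : measurable_fun setT (fun u => ((x u - x0 + S k (w u)) / c)%R).
  apply: measurable_funM => //; apply: measurable_funD.
    exact: measurable_funB.
  exact: (measurableT_comp (measurable_claim_sum C k) mw).
apply: measurable_and.
  by apply: measurable_and; [exact: measurable_fun_ler|exact: measurable_fun_ltr].
apply: measurable_fun_eqn => //.
exact: (measurableT_comp measurable_counting_paths (measurable_fun_pair mu mw)).
Qed.

Let measurable_bool_EFin (d' : measure_display) (U : measurableType d')
    (b : U -> bool) :
  measurable_fun setT b -> measurable_fun setT (fun u => (b u)%:R%:E : \bar R).
Proof.
move=> mb; rewrite (_ : (fun _ => _) = fun u => if b u then 1 else 0).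
  exact: measurable_fun_ifT.
by apply/funext => u; case: (b u).
Qed.

Let hit_ge0 t x w k : 0 <= (hit t x w k)%:R%:E :> \bar R.
Proof. by rewrite lee_fin. Qed.

Lemma occupation_density_ge0 t x w : 0 <= occupation_density t x w.
Proof.
apply: mule_ge0; first by rewrite lee_fin invr_ge0 ltW.
by apply: nneseries_ge0 => k _ _; exact: hit_ge0.
Qed.

Lemma measurable_occupation_density (d' : measure_display)
    (U : measurableType d') (x : U -> R) (w : U -> T) t :
  measurable_fun setT x -> measurable_fun setT w ->
  measurable_fun setT (fun u => occupation_density t (x u) (w u)).
Proof.
move=> mx mw; apply: measurable_funeM.
apply: ge0_emeasurable_sum => [k u _ _|k _]; first exact: hit_ge0.
by apply: measurable_bool_EFin; exact: measurable_hit.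
Qed.

(* The factor may be infinite, hence the detour by the counting measure. *)
Let ge0_nneseriesZl (k : \bar R) (a : nat -> \bar R) :
  0 <= k -> (forall n, 0 <= a n) ->
  \sum_(n <oo) (k * a n) = k * \sum_(n <oo) a n.
Proof.
move=> k0 a0; rewrite -!ge0_integral_count//; last by move=> n; exact: mule_ge0.
exact: ge0_integralZl.
Qed.

(** Time is split according to the number [k] of claims that have occurred, and
    [x = x0 - S k + c s] is substituted in the [k]-th piece. *)
Lemma occupation_formula_path (h : R -> \bar R) (t : R) (w : T) :
  measurable_fun setT h -> (forall x, 0 <= h x) ->
  \int[lebesgue_measure]_(s in `[0%R, t[) h (X s w) =
  \int[lebesgue_measure]_x (h x * occupation_density t x w).
Proof.
move=> mh h0.
have mX : measurable_fun setT (X ^~ w) by exact: measurable_risk_process_joint.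
have mhit k : measurable_fun setT (fun x : R => (hit t x w k)%:R%:E : \bar R).
  by apply: measurable_bool_EFin; exact: measurable_hit.
pose f k x := h x * (hit t x w k)%:R%:E.
have f0 k x : 0 <= f k x by exact: mule_ge0.
have mf k : measurable_fun setT (f k) by exact: emeasurable_funM.
have c0 : 0 <= c^-1%:E :> \bar R by rewrite lee_fin invr_ge0 ltW.
have hit_affine k s : hit t (x0 - S k w + c * s) w k = (0 <= s < t)%R && (M s w == k).
  rewrite /hit /level_hit.
  by have -> : ((x0 - S k w + c * s - x0 + S k w) / c = s)%R by field; rewrite gt_eqF.
transitivity (\int[lebesgue_measure]_s \sum_(k <oo) f k (x0 - S k w + c * s)%R).
  rewrite integral_mkcond; apply: eq_integral => s _; rewrite patchE.
  have -> : (s \in `[0%R, t[%classic) = (0 <= s < t)%R by rewrite mem_setE in_itv.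
  case: ifPn => st; last first.
    by rewrite eseries0// => k _ _; rewrite /f hit_affine (negbTE st) mule0.
  rewrite (@nneseriesD1 _ _ (M s w))//.
  rewrite eseries0 ?adde0; last first.
    by move=> k _ ksM; rewrite /f hit_affine st eq_sym (negbTE ksM) mule0.
  rewrite /f hit_affine st eqxx mule1; congr h.
  by rewrite /X /risk_process -/(claim_sum C _ w) -/S; ring.
rewrite integral_nneseries//; last first.
  move=> k; apply: (measurableT_comp (mf k)).
  by apply: measurable_funD => //; exact: measurable_funM.
transitivity (\sum_(k <oo) c^-1%:E * \int[lebesgue_measure]_x f k x).
  apply: eq_eseriesr => k _; rewrite (ge0_integral_affine (x0 - S k w) c_gt0)//.
  by rewrite muleA -EFinM mulVf ?gt_eqF// mul1e.
transitivity (\sum_(k <oo) \int[lebesgue_measure]_x (c^-1%:E * f k x)).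
  apply: eq_eseriesr => k _; rewrite ge0_integralZl//; exact: mf.
rewrite -integral_nneseries//; last 2 first.
- by move=> k; apply: measurable_funeM; exact: mf.
- by move=> k x _; exact: mule_ge0.
apply: eq_integral => x _; rewrite ge0_nneseriesZl//.
by rewrite ge0_nneseriesZl// /occupation_density muleCA.
Qed.

Definition expected_occupation (t x : R) : \bar R :=
  \int[P]_w occupation_density t x w.

Lemma expected_occupation_ge0 t x : 0 <= expected_occupation t x.
Proof. by apply: integral_ge0 => w _; exact: occupation_density_ge0. Qed.

Let measurable_occupation_density_pair t : measurable_fun [set: R * T]
  (fun z => occupation_density t z.1 z.2).
Proof. exact: (measurable_occupation_density t measurable_fst measurable_snd). Qed.

Lemma measurable_expected_occupation t :
  measurable_fun setT (expected_occupation t).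
Proof.
apply: (measurable_fun_fubini_tonelli_F
  (fun z : R * T => occupation_density t z.1 z.2)) => //.
by move=> z; exact: occupation_density_ge0.
Qed.

Lemma expected_occupation_formula (h : R -> \bar R) (t : R) :
  measurable_fun setT h -> (forall x, 0 <= h x) ->
  \int[P]_w \int[lebesgue_measure]_(s in `[0%R, t[) h (X s w) =
  \int[lebesgue_measure]_x (h x * expected_occupation t x).
Proof.
move=> mh h0.
under eq_integral => w _ do rewrite occupation_formula_path//.
pose F (z : R * T) := h z.1 * occupation_density t z.1 z.2.
have mF : measurable_fun setT F.
  by apply: emeasurable_funM => //; exact: (measurableT_comp mh measurable_fst).
have F0 z : 0 <= F z by apply: mule_ge0 => //; exact: occupation_density_ge0.
rewrite -(@fubini_tonelli _ _ _ _ _ lebesgue_measure P F mF F0) /F/=.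
apply: eq_integral => x _; rewrite ge0_integralZl//.
- exact: measurable_occupation_density.
- by move=> w _; exact: occupation_density_ge0.
Qed.

End occupation.

(** * Expectations along increments *)

Section expectation_of_increments.
Context (R : realType) (d : measure_display) (T : measurableType d)
  (P : probability T R).
Local Open Scope ereal_scope.

(** The law of [(Y, W)] and that of [(Y, W')] on two independent copies of the
    probability space agree on rectangles. *)
Lemma ge0_integral_independent_pair (Y W W' : T -> R) (G : R * R -> \bar R) :
  measurable_fun setT Y -> measurable_fun setT W -> measurable_fun setT W' ->
  (forall A B, measurable A -> measurable B ->
    P (Y @^-1` A `&` W @^-1` B) = P (Y @^-1` A) * P (W' @^-1` B)) ->
  measurable_fun setT G -> (forall z, 0 <= G z) ->
  \int[P]_w G (Y w, W w) = \int[P]_w \int[P]_v G (Y w, W' v).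
Proof.
move=> mY mW mW' YW mG G0.
have mYW : measurable_fun setT (fun w => (Y w, W w)) by exact: measurable_fun_pair.
have mYW' : measurable_fun setT (fun z : T * T => (Y z.1, W' z.2)).
  apply: measurable_fun_pair.
    exact: (measurableT_comp mY measurable_fst).
  exact: (measurableT_comp mW' measurable_snd).
pose f : {mfun T >-> _} :=
  HB.pack (fun w => (Y w, W w)) (isMeasurableFun.Build _ _ _ _ _ mYW).
pose f' : {mfun (T * T)%type >-> _} :=
  HB.pack (fun z : T * T => (Y z.1, W' z.2)) (isMeasurableFun.Build _ _ _ _ _ mYW').
transitivity (\int[pushforward P f]_z G z).
  by rewrite ge0_integral_pushforward.
transitivity (\int[pushforward (P \x P) f']_z G z).
  apply: eq_measure_integral => E mE _.
  apply: finite_measure_rectangles_unique => //.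
    by apply: (le_lt_trans (probability_le1 P measurableT)); rewrite ltry.
  move=> A B mA mB.
  have mYA : measurable (Y @^-1` A) by rewrite -[X in measurable X]setTI; exact: mY.
  have mWB : measurable (W' @^-1` B) by rewrite -[X in measurable X]setTI; exact: mW'.
  rewrite /pushforward.
  transitivity (P (Y @^-1` A `&` W @^-1` B)) => //.
  rewrite YW//.
  by rewrite -(product_measure1E _ _ mYA mWB).
rewrite ge0_integral_pushforward//.
rewrite (fubini_tonelli1 (G \o f'))//.
  exact: (measurableT_comp mG mYW').
by move=> z; exact: G0.
Qed.

Lemma bounded_fun_integrable (d' : measure_display) (U : measurableType d')
    (mu : {measure set U -> \bar R}) (D : set U) (f : U -> R) (K : R) :
  measurable D -> mu D < +oo -> measurable_fun D f ->
  (forall x, `|f x| <= K)%R -> mu.-integrable D (EFin \o f).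
Proof.
move=> mD Dfin mf fK; apply: measurable_bounded_integrable => //.
exists K; split; first exact: num_real.
by move=> y Ky x _; exact: le_trans (fK x) (ltW Ky).
Qed.

Variables (M : R -> T -> nat) (C : nat -> {RV P >-> R}) (x0 c : R).
Hypothesis M_paths : counting_paths M.
Hypothesis c_gt0 : (0 < c)%R.

Let X := risk_process x0 c M C.

Variables (t e : R).
Hypothesis X_increments : forall s A B,
  (0 <= s)%R -> measurable A -> measurable B ->
  P (X s @^-1` A `&` (fun w => X (s + e)%R w - X s w)%R @^-1` B) =
  P (X s @^-1` A) * P ((fun w => X e w - x0)%R @^-1` B).

Let incr s w := (X s w, X (s + e)%R w - X s w)%R.

Let mX s : measurable_fun setT (X s).
Proof. exact: measurable_risk_process. Qed.

Let mXe : measurable_fun setT (fun w => X e w - x0)%R.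
Proof. exact: measurable_funB. Qed.

Let measurable_incr (d' : measure_display) (U : measurableType d')
    (s : U -> R) (w : U -> T) : measurable_fun setT s -> measurable_fun setT w ->
  measurable_fun setT (fun u => incr (s u) (w u)).
Proof.
move=> ms mw; apply: measurable_fun_pair.
  exact: measurable_risk_process_joint.
apply: measurable_funB; apply: measurable_risk_process_joint => //.
exact: measurable_funD.
Qed.

(** At a fixed time the increment is integrated out first; what remains is a
    function of the position alone, to which the occupation formula applies. *)
Lemma ge0_increments_occupation (G : R * R -> \bar R) :
  measurable_fun setT G -> (forall z, 0 <= G z) ->
  \int[P]_w \int[lebesgue_measure]_(s in `[0%R, t]) G (incr s w) =
  \int[lebesgue_measure]_x ((\int[P]_w G (x, X e w - x0)%R) *
                            expected_occupation M C x0 c t x).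
Proof.
move=> mG G0.
pose h x := \int[P]_w G (x, X e w - x0)%R.
have mh : measurable_fun setT h.
  apply: (measurable_fun_fubini_tonelli_F
    (fun z : R * T => G (z.1, X e z.2 - x0)%R)) => //.
  apply: (measurableT_comp mG); apply: measurable_fun_pair.
    exact: measurable_fst.
  exact: (measurableT_comp mXe measurable_snd).
have h0 x : 0 <= h x by apply: integral_ge0.
rewrite -(expected_occupation_formula C x0 M_paths c_gt0 t mh h0).
pose D := [set` `[0%R, t[] : set R.
have mD : measurable D by exact: measurable_itv.
have tonelli (F : R * T -> \bar R) : measurable_fun setT F -> (forall z, 0 <= F z) ->
    \int[P]_w \int[lebesgue_measure]_(s in D) F (s, w) =
    \int[lebesgue_measure]_(s in D) \int[P]_w F (s, w).
  by move=> mF F0; exact: fubini_tonelli_in.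
transitivity (\int[P]_w \int[lebesgue_measure]_(s in D) G (incr s w)).
  apply: eq_integral => w _; rewrite integral_itv_bndo_bndc//.
  apply: measurable_funTS; apply: (measurableT_comp mG).
  exact: (measurable_incr (s := id) (w := cst w)).
rewrite (tonelli (fun z => G (incr z.1 z.2)))//=; last first.
  by apply: (measurableT_comp mG); exact: measurable_incr.
rewrite (tonelli (fun z => h (X z.1 z.2)))//=; last first.
  apply: (measurableT_comp mh).
  exact: (measurable_risk_process_joint C x0 c M_paths measurable_fst measurable_snd).
apply: eq_integral => s; rewrite inE /D/= in_itv/= => /andP[s0 _].
apply: ge0_integral_independent_pair => //; first exact: measurable_funB.
by move=> *; exact: X_increments.
Qed.

Let horizon_finite : lebesgue_measure ([set` `[0%R, t]] : set R) < +oo.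
Proof.
by rewrite lebesgue_measure_itv/=; case: ifP => _; rewrite ?ltry// -EFinB ltry.
Qed.

(** The total mass is [t], by the previous lemma for the constant function
    [1]. *)
Lemma integrable_expected_occupation :
  lebesgue_measure.-integrable setT (expected_occupation M C x0 c t).
Proof.
apply/integrableP; split; first exact: measurable_expected_occupation.
under eq_integral => x _ do rewrite gee0_abs ?expected_occupation_ge0//.
have := @ge0_increments_occupation (cst 1) (measurable_cst _) (fun=> lee01).
have one x : \int[P]_w cst 1 (x, X e w - x0)%R = 1.
  by rewrite (eq_integral (cst 1))// integral_cst// mul1e; exact: probability_setT.
under [X in _ = X]eq_integral => x _ do rewrite one mul1e.
move=> <-.
under eq_integral => w _ do rewrite (eq_integral (cst 1))// integral_cst// mul1e.
rewrite integral_cst// [X in _ * X](_ : _ = 1) ?mule1; last exact: probability_setT.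
exact: horizon_finite.
Qed.

(** Boundedness makes all the integrals of the positive and negative parts of
    [g] finite, so that they may be subtracted.  On the right-hand side this is
    possible only at levels where the expected occupation is finite, that is,
    almost everywhere. *)
Lemma bounded_increments_occupation (g : R * R -> R) (K : R) :
  measurable_fun setT g -> (forall z, `|g z| <= K)%R ->
  \int[P]_w (\int[lebesgue_measure]_(s in `[0, t]) g (incr s w))%R%:E =
  \int[lebesgue_measure]_x ((\int[P]_w g (x, X e w - x0))%R%:E *
                            expected_occupation M C x0 c t x).
Proof.
move=> mg gK.
pose D := [set` `[0%R, t]] : set R.
have mD : measurable D by exact: measurable_itv.
have Dfin : lebesgue_measure D < +oo by exact: horizon_finite.
pose gp z := Num.max (g z) 0%R; pose gn z := Num.max (- g z)%R 0%R.
have gE z : g z = (gp z - gn z)%R.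
  by rewrite /gp /gn; case: (lerP (g z) 0) => ?; case: (lerP (- g z) 0) => ?; lra.
have K0 : (0 <= K)%R by apply: le_trans (gK (0, 0)%R); exact: normr_ge0.
have gp0 z : (0 <= gp z)%R by rewrite le_max lexx orbT.
have gn0 z : (0 <= gn z)%R by rewrite le_max lexx orbT.
have gpK z : (`|gp z| <= K)%R.
  by rewrite ger0_norm// ge_max K0 andbT (le_trans _ (gK z))// ler_norm.
have gnK z : (`|gn z| <= K)%R.
  by rewrite ger0_norm// ge_max K0 andbT (le_trans _ (gK z))// -normrN ler_norm.
have mgp : measurable_fun setT gp by apply: measurable_maxr.
have mgn : measurable_fun setT gn.
  by apply: measurable_maxr => //; exact: measurable_funN.
pose I (k : R * R -> R) w := (\int[lebesgue_measure]_(s in D) k (incr s w))%R.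
pose h (k : R * R -> R) x := (\int[P]_w k (x, X e w - x0))%R.
have int_time (k : R * R -> R) w : measurable_fun setT k -> (forall z, `|k z| <= K)%R ->
    lebesgue_measure.-integrable D (EFin \o (fun s => k (incr s w))).
  move=> mk kK; apply: (bounded_fun_integrable (K := K)) => //.
  apply: measurable_funTS; apply: (measurableT_comp mk).
  exact: (measurable_incr (s := id) (w := cst w)).
have int_law (k : R * R -> R) x : measurable_fun setT k -> (forall z, `|k z| <= K)%R ->
    P.-integrable setT (EFin \o (fun w => k (x, X e w - x0)%R)).
  move=> mk kK; apply: (bounded_fun_integrable (K := K)) => //.
    by apply: (le_lt_trans (probability_le1 P measurableT)); rewrite ltry.
  by apply: (measurableT_comp mk); apply: measurable_fun_pair.
have IE (k : R * R -> R) w : measurable_fun setT k -> (forall z, `|k z| <= K)%R ->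
    (I k w)%:E = \int[lebesgue_measure]_(s in D) (k (incr s w))%:E.
  by move=> mk kK; rewrite fineK//; apply: integrable_fin_num => //; exact: int_time.
have hE (k : R * R -> R) x : measurable_fun setT k -> (forall z, `|k z| <= K)%R ->
    (h k x)%:E = \int[P]_w (k (x, X e w - x0)%R)%:E.
  by move=> mk kK; rewrite fineK//; apply: integrable_fin_num => //; exact: int_law.
have mh (k : R * R -> R) : measurable_fun setT k -> (forall z, `|k z| <= K)%R ->
    (forall z, 0 <= k z)%R -> measurable_fun setT (h k).
  move=> mk kK k0; apply/measurable_EFinP.
  rewrite (_ : _ \o _ = fun x => \int[P]_w (k (x, X e w - x0)%R)%:E); last first.
    by apply/funext => x; rewrite /= hE.
  apply: (measurable_fun_fubini_tonelli_F
    (fun z : R * T => (k (z.1, X e z.2 - x0)%R)%:E)) => //.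
    apply/measurable_EFinP; apply: (measurableT_comp mk); apply: measurable_fun_pair.
      exact: measurable_fst.
    exact: (measurableT_comp mXe measurable_snd).
  by move=> z; rewrite lee_fin.
have hK (k : R * R -> R) x : measurable_fun setT k -> (forall z, `|k z| <= K)%R ->
    (`|h k x| <= K)%R.
  move=> mk kK; rewrite /h (le_trans (le_normr_Rintegral _ (int_law _ _ mk kK)))//.
  rewrite -lee_fin fineK; last first.
    by apply: integrable_fin_num => //; apply: integrable_norm; exact: int_law.
  apply: (@le_trans _ _ (\int[P]_w K%:E)); last first.
    by rewrite integral_cst// [X in _ * X](_ : _ = 1) ?mule1//; exact: probability_setT.
  apply: ge0_le_integral => //.
  - apply/measurable_EFinP; apply: measurableT_comp => //.
    by apply: (measurableT_comp mk); exact: measurable_fun_pair.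
  - by move=> w _; rewrite lee_fin.
have int_h (k : R * R -> R) : measurable_fun setT k -> (forall z, `|k z| <= K)%R ->
    (forall z, 0 <= k z)%R ->
    lebesgue_measure.-integrable setT
      (fun x => (h k x)%:E * expected_occupation M C x0 c t x).
  move=> mk kK k0; apply: integrableMr => //.
  - exact: mh.
  - exists K; split; first exact: num_real.
    by move=> y Ky x _; exact: le_trans (hK _ _ mk kK) (ltW Ky).
  - exact: integrable_expected_occupation.
have ge0_case (k : R * R -> R) : measurable_fun setT k -> (forall z, `|k z| <= K)%R ->
    (forall z, 0 <= k z)%R ->
    \int[P]_w (I k w)%:E =
    \int[lebesgue_measure]_x ((h k x)%:E * expected_occupation M C x0 c t x).
  move=> mk kK k0; under eq_integral => w _ do rewrite IE//.
  under [RHS]eq_integral => x _ do rewrite hE//.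
  apply: (@ge0_increments_occupation (EFin \o k)).
    exact/measurable_EFinP.
  by move=> z; rewrite lee_fin.
have int_I (k : R * R -> R) : measurable_fun setT k -> (forall z, `|k z| <= K)%R ->
    (forall z, 0 <= k z)%R -> P.-integrable setT (EFin \o I k).
  move=> mk kK k0; apply/integrableP; split.
    rewrite (_ : _ \o _ = fun w =>
        \int[lebesgue_measure]_(s in D) (k (incr s w))%:E); last first.
      by apply/funext => w; rewrite /= IE.
    apply: (@measurable_integral_in _ _ _ _ _ lebesgue_measure D
      (fun z : R * T => (k (incr z.1 z.2))%:E)) => //.
      by apply/measurable_EFinP; apply: (measurableT_comp mk); exact: measurable_incr.
    by move=> z; rewrite lee_fin.
  under eq_integral => w _ do rewrite /= ger0_norm ?Rintegral_ge0//.
  rewrite ge0_case//; apply: integrable_lty => //; exact: int_h.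
transitivity (\int[P]_w ((I gp w)%:E - (I gn w)%:E)).
  apply: eq_integral => w _; rewrite -EFinB /I -RintegralB//; [|exact: int_time..].
  by congr EFin; apply: eq_Rintegral => s _; rewrite gE.
rewrite integralB_EFin//; [|exact: int_I..].
rewrite !ge0_case// -integralB//; [|exact: int_h..].
have [Z [mZ Z0 Zfin]] := integrable_ae measurableT integrable_expected_occupation.
apply: (eq_integral_off_null mZ Z0) => x Zx.
have fin : expected_occupation M C x0 c t x \is a fin_num.
  by apply: contrapT => nfin; apply/Zx/Zfin => H; apply: nfin; exact: H.
rewrite -(fineK fin) -!EFinM -EFinB -mulrBl; congr (_ * _)%:E.
rewrite /h -RintegralB//; [|exact: int_law..].
by apply: eq_Rintegral => w _; rewrite gE.
Qed.

End expectation_of_increments.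

(** * The local time as occupation density *)

Section local_time_density.
Context (R : realType) (d : measure_display) (T : measurableType d)
  (P : probability T R).

(** Away from the two end points of the path the half terms vanish, and
    [level_crossings] counts the visits. *)
Lemma local_time_occupation_density (M : R -> T -> nat)
    (C : nat -> {RV P >-> R}) (x0 c t y : R) (w : T) :
  counting_paths M -> 0 < c -> 0 <= t ->
  y <> x0 -> risk_process x0 c M C t w <> y ->
  (local_time x0 c (risk_process x0 c M C) t y w)%:E =
  occupation_density M C x0 c t y w.
Proof.
move=> M_paths c0 t0 /eqP yx0 /eqP Xty.
have n_nd s u : 0 <= s -> s <= u -> (M s w <= M u w)%N.
  by move=> _; exact: counting_nd.
have n_rc s : 0 <= s -> exists2 e : R, 0 < e &
    forall u : R, s <= u -> u < s + e -> M u w = M s w.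
  by move=> _; exact: counting_rc.
have := @level_crossings _ (M ^~ w) (fun k => claim_sum C k w) x0 c c0 n_nd n_rc y t t0.
rewrite /= -/(risk_process x0 c M C t w) => crossings.
have -> : occupation_density M C x0 c t y w =
    (c^-1 * \sum_(k < (M t w).+1) (hit M C x0 c t y w k)%:R)%:E.
  rewrite /occupation_density (nneseries_split 0 (M t w).+1); last first.
    by move=> k _; rewrite lee_fin.
  rewrite eseries0 ?adde0 ?add0n.
    by rewrite big_mkord sumEFin -EFinM.
  move=> k tk _.
  by rewrite /hit level_hit_ge.
rewrite /hit -crossings; congr (EFin (_ * _)).
have -> : x0 + c * 0 - \sum_(k < M 0 w) C k w = x0.
  by rewrite counting_start// big_ord0 mulr0 addr0 subr0.
have off v : v != y -> \1_[set y] v = 0 :> R.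
  by move=> /eqP vy; rewrite indicE memNset.
rewrite !off//; last by rewrite eq_sym.
by rewrite mulr0 add0r subr0.
Qed.

(** By Tonelli, the integral of [P (Y = x)] over [x] is the expected length of
    a single point. *)
Lemma law_atoms_null (Y : T -> R) : measurable_fun setT Y ->
  exists A : set R, [/\ measurable A, lebesgue_measure A = 0%E &
    forall x, ~ A x -> P (Y @^-1` [set x]) = 0%E].
Proof.
move=> mY.
pose F (z : R * T) : \bar R := (\1_[set z : R * T | Y z.2 = z.1] z)%:E.
have mE : measurable [set z : R * T | Y z.2 = z.1].
  have := @measurable_fun_eqr _ _ _ setT (fun z : R * T => Y z.2) (fun z => z.1)
    (measurableT_comp mY measurable_snd) measurable_fst measurableT [set true] I.
  rewrite setTI; congr measurable; apply/seteqP.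
  by split => z /= /eqP.
have mF : measurable_fun setT F by apply/measurable_EFinP; exact: measurable_indic.
have F0 z : (0 <= F z)%E by rewrite lee_fin.
have FE x : (\int[P]_w F (x, w) = P (Y @^-1` [set x]))%E.
  have mYx : measurable (Y @^-1` [set x]).
    by rewrite -[X in measurable X]setTI; exact: mY.
  transitivity (\int[P]_w (\1_(Y @^-1` [set x]) w)%:E)%E => //.
  by rewrite integral_indic// setIT.
have mf : measurable_fun setT (fun x => P (Y @^-1` [set x])).
  rewrite (_ : (fun _ => _) = fun x => (\int[P]_w F (x, w))%E); last first.
    by apply/funext => x; rewrite FE.
  exact: measurable_fun_fubini_tonelli_F.
have : (\int[lebesgue_measure]_x `|P (Y @^-1` [set x])| = 0)%E.
  under eq_integral => x _ do rewrite gee0_abs// -FE.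
  rewrite (@fubini_tonelli _ _ _ _ _ lebesgue_measure P F mF F0).
  rewrite integral0_eq// => w _.
  transitivity (\int[lebesgue_measure]_x (\1_[set Y w] x)%:E)%E.
    apply: eq_integral => x _; rewrite /F !indicE; congr (_%:R%:E)%R; congr nat_of_bool.
    by apply/idP/idP => /set_mem/= /esym/mem_set.
  by rewrite integral_indic// setIT; exact: lebesgue_measure_set1.
move=> /(proj1 (ae_eq_integral_abs lebesgue_measure measurableT mf)).
move=> [A [mA A0 Asub]].
exists A; split => // x Ax; apply: contrapT => Px.
by apply/Ax/Asub => H; apply: Px; exact: H.
Qed.

End local_time_density.

Theorem theorem2 (R : realType) (d : measure_display) (T : measurableType d)
    (P : probability T R) (x0 c alpha : R)
    (N : R -> {RV P >-> nat}) (C : nat -> {RV P >-> R})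
    (X := risk_process x0 c N C)
    (L := local_time x0 c X) :
  0 <= x0 -> 0 < c -> 0 < alpha ->
  poisson_process P alpha N ->
  mutually_independent P C ->
  identically_distributed P C ->
  (forall k w, 0 <= C k w) ->
  independent_systems P (family_sigma [set s : R | 0 <= s] N)
                        (family_sigma [set: nat] C) ->
  P.-integrable [set: T] (EFin \o C 0%N) ->
  has_density P (C 0%N) ->
  forall (t : R) (g : R * R -> R), 0 < t ->
  measurable_fun [set: R * R] g ->
  (exists M : R, forall z, `|g z| <= M) ->
  forall eps : R, 0 < eps ->
  ('E_P[fun w => (\int[lebesgue_measure]_(s in `[0, t])
                   g (X s w, X (s + eps) w - X s w))%R] =
   \int[lebesgue_measure]_x
     ('E_P[fun w => g (x, X eps w - x0)%R] * 'E_P[L t x]))%E.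
Proof.
move=> _ c0 _ N_poisson C_indep C_id _ NC_indep _ _ t g t0 mg [K gK] e e0.
have [Z [mZ PZ NM M_paths]] := poisson_regularization N_poisson.
pose M := regularize Z N; pose Xb := risk_process x0 c M C.
have XE s w : 0 <= s -> ~ Z w -> X s w = Xb s w.
  by move=> s0 Zw; rewrite /X /Xb /risk_process /M NM.
have mXb s : measurable_fun setT (Xb s) by exact: measurable_risk_process.
have X_increments s A B : 0 <= s -> measurable A -> measurable B ->
    (P (Xb s @^-1` A `&` (fun w => Xb (s + e) w - Xb s w)%R @^-1` B) =
     P (Xb s @^-1` A) * P ((fun w => Xb e w - x0)%R @^-1` B))%E.
  move=> s0 mA mB.
  apply: risk_process_increment_rectangle => // [s' n F s'0 CF|s' e' n m F s'0 e'0 CF].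
    exact: (regularized_poisson_indep NC_indep mZ PZ NM M_paths).
  exact: (regularized_poisson_increment_indep N_poisson NC_indep mZ PZ NM M_paths).
have expE (Y : T -> R) : ('E_P[Y] = \int[P]_w (Y w)%:E)%E by rewrite unlock.
have intE : ('E_P[fun w => (\int[lebesgue_measure]_(s in `[0, t])
      g (X s w, X (s + e) w - X s w))%R] =
    \int[P]_w (\int[lebesgue_measure]_(s in `[0, t])
      g (Xb s w, Xb (s + e) w - Xb s w))%R%:E)%E.
  rewrite expE; apply: (eq_integral_off_null mZ PZ) => w Zw.
  congr EFin; apply: eq_Rintegral => s.
  rewrite inE/= in_itv/= => /andP[s0 _].
  by rewrite !XE// addr_ge0// ltW.
rewrite intE.
rewrite (bounded_increments_occupation M_paths c0 t X_increments mg gK).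
(* The levels discarded are the atoms of the law at time [t], and [x0]; there the
   half terms of the local time may contribute. *)
have [A [mA A0 XbA]] := law_atoms_null P (mXb t).
have mA0 : measurable (A `|` [set x0]) by exact: measurableU.
have A00 : lebesgue_measure (A `|` [set x0]) = 0%E.
  by rewrite measureU0//; exact: lebesgue_measure_set1.
apply: (eq_integral_off_null (mu := lebesgue_measure) mA0 A00).
move=> x /not_orP[Ax xx0]; congr (_ * _)%E.
  rewrite expE fineK; last first.
    apply: integrable_fin_num => //; apply: (bounded_fun_integrable (K := K)) => //.
      by apply: (le_lt_trans (probability_le1 P measurableT)); rewrite ltry.
    apply: (measurableT_comp mg); apply: measurable_fun_pair => //.
    by apply: measurable_funB => //; exact: mXb.
  by apply: (eq_integral_off_null mZ PZ) => w Zw; rewrite XE// ltW.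
have mXbx : measurable (Xb t @^-1` [set x]).
  by rewrite -[X in measurable X]setTI; exact: mXb.
have mZx : measurable (Z `|` Xb t @^-1` [set x]) by exact: measurableU.
have PZx : P (Z `|` Xb t @^-1` [set x]) = 0%E by rewrite measureU0//; exact: XbA.
rewrite expE; apply: (eq_integral_off_null mZx PZx).
move=> w /not_orP[Zw Xbx].
rewrite -local_time_occupation_density//; last exact: ltW.
congr EFin; rewrite /L /local_time -/Xb; congr (_ * _).
rewrite XE ?ltW//; congr (_ - _).
apply: eq_fsbigr => s; rewrite inE/= in_itv/= => /andP[s0 _].
rewrite XE ?ltW//; congr (_ - \1_(_) _).
(* The left limits at [s > 0] depend on values at positive times only. *)
rewrite /left_limit; congr lim.
have near_eq : \forall u \near s^'-, X u w = Xb u w.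
  near=> u; apply: XE => //; near: u.
  by apply: nbhs_left_ge.
apply/seteqP; split => B /=; rewrite !nbhs_simpl /= => HB.
  by apply: filterS2 near_eq HB => u /= ->.
by apply: filterS2 near_eq HB => u /= <-.
Unshelve. all: by end_near. Qed.
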